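(* Let $k\subset K$ be a finite totally ramified Galois extension of complete discrete valuation fields with Galois group $G$, degree $n$ and ramification depth $d$, and let $i\in\mathbb Z$. (5) For every $\alpha\in X_i$ one has $\alpha\cdot(1\otimes\pi^{-i})\in X_0$ and $r_X\big(\alpha\cdot(1\otimes\pi^{-i})\big)=p_{d+i}(\phi(\alpha))$. (6) For every $\alpha\in K\otimes_kK$, if $\phi(\alpha)=\sum_{\sigma\in G}a_\sigma\sigma$ then $\phi(t(\alpha))=\sum_{\sigma\in G}\sigma(a_{\sigma^{-1}})\sigma$.
   Context: Notation: $O_K$, $\mathfrak m$ the ring of integers of $K$ and its maximal ideal, $O_k$ that of $k$, $\bar k$ the residue field, $r:O_K\to\bar k$ reduction, $v$ the valuation of $K$ with $v(K^* )=\mathbb Z$, $\pi$ a fixed uniformizer of $K$, $d=v(\mathfrak D_{K/k})-n+1$ ($\mathfrak D_{K/k}$ the different), $c_\pi=\mathrm{Tr}_{K/k}(\pi^{-d})\in O_k^*$. Tensor products are over $k$; for $O_k$-submodules $A,B\subset K$, $A\otimes B$ is the $O_k$-submodule of $K\otimes_kK$ generated by $a\otimes b$. $X_i=\sum_{j\in\mathbb Z}\mathfrak m^j\otimes\mathfrak m^{i-j}$; $X_0$ is a ring and $r_X:X_0/X_1\to R=\bar k[X]/(X^n-1)$ is the unique unital $\bar k$-algebra isomorphism sending the class of $\pi\otimes\pi^{-1}$ to $X$ (we also write $r_X(\beta)$ for $\beta\in X_0$). $t$ is the swap $x\otimes y\mapsto y\otimes x$. $\phi:K\otimes_kK\to K[G]$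 is the $k$-linear bijection with $\phi(x\otimes y)=x\sum_{\sigma\in G}\sigma(y)\sigma$; it is known that $\phi(X_i)=\mathfrak C_{i+d}$, where $\mathfrak C_l=\{f\in K[G]: v(f(x))-v(x)\ge l\ \forall x\in K^*\}$ and $f=\sum a_\sigma\sigma$ acts by $f(x)=\sum a_\sigma\sigma(x)$. For $f\in\mathfrak C_l$, $p_l(f)=r(c_\pi)^{-1}\sum_{j=0}^{n-1}r\big(f(\pi^{j-l})/\pi^j\big)X^j\in R$. *)

(* Defs.v *)
From HB Require Import structures.
From mathcomp Require Import all_boot all_order all_algebra all_fingroup all_field.
Set Implicit Arguments. Unset Strict Implicit. Unset Printing Implicit Defensive.
Import Order.TTheory GRing.Theory Num.Theory.
Local Open Scope ring_scope.

(* A valuation is encoded as v : K -> int, meaningful on K^* only.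
   [vge v x j] means x \in m^j, i.e. x = 0 or v x >= j. *)
Definition vge (K : fieldType) (v : K -> int) (x : K) (j : int) : bool :=
  (x == 0) || (j <= v x).

Definition normalized_dvaluation (K : fieldType) (v : K -> int) : Prop :=
  [/\ forall x y : K, x != 0 -> y != 0 -> v (x * y) = v x + v y,
      forall x y : K, x != 0 -> y != 0 -> x + y != 0 ->
        Num.min (v x) (v y) <= v (x + y)
    & forall z : int, exists x : K, x != 0 /\ v x = z].

Definition vcauchy (K : fieldType) (v : K -> int) (u : nat -> K) : Prop :=
  forall N : int, exists M : nat, forall p q : nat, (M <= p)%N -> (M <= q)%N ->
    vge v (u p - u q) N.
Definition vconverges (K : fieldType) (v : K -> int) (u : nat -> K) (l : K) : Prop :=
  forall N : int, exists M : nat, forall p : nat, (M <= p)%N -> vge v (u p - l) N.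
Definition vcomplete (K : fieldType) (v : K -> int) : Prop :=
  forall u : nat -> K, vcauchy v u -> exists l, vconverges v u l.

Definition vcomplete_base (k : fieldType) (K : fieldExtType k) (v : K -> int) : Prop :=
  forall u : nat -> k, vcauchy v (fun m => (u m)%:A) ->
    exists l : k, vconverges v (fun m => (u m)%:A) l%:A.

Definition residue_map (K : fieldType) (v : K -> int) (kbar : fieldType)
    (r : K -> kbar) : Prop :=
  [/\ forall x y, vge v x 0 -> vge v y 0 -> r (x + y) = r x + r y,
      forall x y, vge v x 0 -> vge v y 0 -> r (x * y) = r x * r y,
      r 1 = 1,
      forall x, vge v x 0 -> (r x == 0) = vge v x 1
    & forall z : kbar, exists x, vge v x 0 /\ r x = z].

Definition bilinear_map (k : fieldType) (K W : lmodType k) (f : K -> K -> W) : Prop :=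
  (forall x, linear (f x)) /\ (forall y, linear (f^~ y)).

Definition tensor_square (k : fieldType) (K : fieldExtType k) (T : comAlgType k)
    (tens : K -> K -> T) : Prop :=
  [/\ bilinear_map tens,
      forall (W : lmodType k) (f : K -> K -> W), bilinear_map f ->
        exists g : T -> W, [/\ linear g, forall x y, g (tens x y) = f x y &
          forall g' : T -> W, linear g' -> (forall x y, g' (tens x y) = f x y) ->
            g' =1 g],
      forall x y x' y', tens x y * tens x' y' = tens (x * x') (y * y')
    & tens 1 1 = 1].

(* X_i = sum_j m^j (x) m^(i-j): the O_k-submodule generated by the a (x) b,
   a \in m^j, b \in m^(i-j). *)
Definition inX (k : fieldType) (K : fieldExtType k) (T : comAlgType k)
    (v : K -> int) (tens : K -> K -> T) (i : int) (beta : T) : Prop :=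
  exists s : seq (k * K * K),
    [/\ all (fun p => vge v (p.1.1)%:A 0) s,
        forall p, p \in s -> exists j : int, vge v p.1.2 j && vge v p.2 (i - j)
      & beta = \sum_(p <- s) p.1.1 *: tens p.1.2 p.2].

(* An element f = sum a_sigma sigma of K[G] is the function sigma |-> a_sigma. *)
Definition gr_act (k : fieldType) (K : splittingFieldType k)
    (f : {ffun gal_of {:K} -> K}) (x : K) : K :=
  \sum_(s in ('Gal({:K} / 1%VS))%g) f s * s x.

Definition p_map (k : fieldType) (K : splittingFieldType k) (kbar : fieldType)
    (r : K -> kbar) (n : nat) (pi cpi : K) (l : int)
    (f : {ffun gal_of {:K} -> K}) : {poly kbar} :=
  (r cpi)^-1 *: \sum_(j < n) r (gr_act f (pi ^ (j%:Z - l)) / pi ^+ j) *: 'X^j.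

(* reduction modulo X^n - 1, i.e. the class in R = kbar[X]/(X^n - 1) *)
Definition redR (kbar : fieldType) (n : nat) (p : {poly kbar}) : {poly kbar} :=
  p %% ('X^n - 1).

(* Main.v *)
Require Import Defs.
From HB Require Import structures.
From mathcomp Require Import all_boot all_order all_algebra all_fingroup all_field.
From mathcomp Require Import zify.
Import Order.TTheory GRing.Theory Num.Theory.
Local Open Scope ring_scope.

(** K is the direct sum of the lines k pi^m, 0 <= m < n, whose nonzero elements
have valuations distinct mod n; hence O_k maps onto the residue field. By the
definition of d, Tr(m^b) lies in m^(b+d), and Tr induces on m^(-d)/m^(1-d) the
map w |-> r(w pi^d) r(c_pi), with r(c_pi) nonzero because m^(-d) is not
contained in the inverse different multiplied by a uniformizer of k.
By additivity (5) reduces to alpha = x (x) y with x in m^a, y in m^(i-a).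
Moving a scalar of k across the tensor sign puts a in [0, n), and then both
sides equal r(x y pi^(-i)) X^(a mod n): on the right-hand side the other
coefficients vanish since traces have valuation in nZ.
(6) holds on pure tensors, and both sides are k-linear in alpha. *)

Set Implicit Arguments.
Unset Strict Implicit.
Unset Printing Implicit Defensive.

(** * Valuations, powers of a uniformizer and residues *)

Section Valuation.
Variables (K : fieldType) (v : K -> int).
Hypothesis Hv : normalized_dvaluation v.

Lemma vge0 j : vge v 0 j. Proof. by rewrite /vge eqxx. Qed.

Lemma vge_neq0 x j : x != 0 -> vge v x j = (j <= v x).
Proof. by rewrite /vge => /negPf ->. Qed.

Lemma vge_le x i j : i <= j -> vge v x j -> vge v x i.
Proof.
by rewrite /vge => le_ij /orP[->//|/(le_trans le_ij) ->]; rewrite orbT.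
Qed.

Lemma valM x y : x != 0 -> y != 0 -> v (x * y) = v x + v y.
Proof. by case: Hv => H _ _; exact: H. Qed.

Lemma val1 : v 1 = 0.
Proof. by apply: (addrI (v 1)); rewrite addr0 -valM ?oner_neq0 // mulr1. Qed.

Lemma valN1 : v (- 1) = 0.
Proof.
have N1 : (-1 : K) != 0 by rewrite oppr_eq0 oner_neq0.
by have := valM N1 N1; rewrite mulrNN mulr1 val1; set a := v _; lia.
Qed.

Lemma valV x : x != 0 -> v x^-1 = - v x.
Proof.
move=> x0; apply: (addrI (v x)).
by rewrite -valM ?invr_neq0 // divff // val1 subrr.
Qed.

Lemma valX x (m : nat) : x != 0 -> v (x ^+ m) = v x * m%:Z.
Proof.
move=> x0; elim: m => [|m IHm]; first by rewrite expr0 val1 mulr0.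
by rewrite exprS valM ?expf_neq0 // IHm; lia.
Qed.

Lemma valXz x (z : int) : x != 0 -> v (x ^ z) = v x * z.
Proof.
move=> x0; case: z => m; first by rewrite -exprnP valX.
by rewrite NegzE -exprnN valV ?expf_neq0 // valX // mulrN.
Qed.

Lemma vgeM l x y i j : vge v x i -> vge v y j -> l <= i + j -> vge v (x * y) l.
Proof.
have [->|x0] := eqVneq x 0; first by move=> *; rewrite mul0r vge0.
have [->|y0] := eqVneq y 0; first by move=> *; rewrite mulr0 vge0.
by rewrite !vge_neq0 ?mulf_neq0 // valM //; lia.
Qed.

Lemma vgeN x j : vge v (- x) j = vge v x j.
Proof.
have [->|x0] := eqVneq x 0; first by rewrite oppr0.
rewrite !vge_neq0 ?oppr_eq0 // -mulN1r valM ?oppr_eq0 ?oner_neq0 //.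
by rewrite valN1 add0r.
Qed.

Lemma vgeD x y j : vge v x j -> vge v y j -> vge v (x + y) j.
Proof.
have [->|x0] := eqVneq x 0; first by rewrite add0r.
have [->|y0] := eqVneq y 0; first by rewrite addr0.
have [->|xy0] := eqVneq (x + y) 0; first by move=> *; rewrite vge0.
rewrite !vge_neq0 // => xj yj; case: Hv => _ H _.
by apply: le_trans (H _ _ x0 y0 xy0); rewrite le_min xj.
Qed.

Lemma vgeB x y j : vge v x j -> vge v y j -> vge v (x - y) j.
Proof. by move=> ? ?; rewrite vgeD ?vgeN. Qed.

Lemma vge_sum (I : Type) (s : seq I) (P : pred I) (F : I -> K) j :
  (forall i, P i -> vge v (F i) j) -> vge v (\sum_(i <- s | P i) F i) j.
Proof.
move=> H; apply: (big_ind (fun x => vge v x j)) => //; first exact: vge0.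
by move=> x y; exact: vgeD.
Qed.

Variable pi : K.
Hypotheses (pi0 : pi != 0) (Hpi : v pi = 1).

Lemma val_unif (z : int) : v (pi ^ z) = z.
Proof. by rewrite valXz // Hpi mul1r. Qed.

Lemma unif_neq0 (z : int) : pi ^ z != 0. Proof. by rewrite expfz_neq0. Qed.

Lemma vge_unif (z : int) : vge v (pi ^ z) z.
Proof. by rewrite vge_neq0 ?unif_neq0 // val_unif. Qed.

Lemma vgeMu l x j z : vge v x j -> l <= j + z -> vge v (x * pi ^ z) l.
Proof. by move=> xj; apply: vgeM xj (vge_unif z). Qed.

Variables (kbar : fieldType) (r : K -> kbar).
Hypothesis Hr : residue_map v r.

Lemma resD x y : vge v x 0 -> vge v y 0 -> r (x + y) = r x + r y.
Proof. by case: Hr => H _ _ _ _; exact: H. Qed.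

Lemma resM x y : vge v x 0 -> vge v y 0 -> r (x * y) = r x * r y.
Proof. by case: Hr => _ H _ _ _; exact: H. Qed.

Lemma res_eq0 x : vge v x 1 -> r x = 0.
Proof.
move=> x1; apply/eqP; case: Hr => _ _ _ H _.
by rewrite H //; apply: vge_le x1.
Qed.

Lemma res_congr x y : vge v y 0 -> vge v (x - y) 1 -> r x = r y.
Proof.
move=> y0 xy; rewrite -[x](subrK y) resD // ?(res_eq0 xy) ?add0r //.
exact: vge_le xy.
Qed.

End Valuation.

Lemma ord_mulz_inj (n : nat) (a b : int) (i j : 'I_n) :
  a * n%:Z + i%:Z = b * n%:Z + j%:Z -> i = j.
Proof.
move/(congr1 (modz^~ n%:Z)); rewrite !modzMDl !modz_small ?ltz_nat ?ltn_ord //.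
by case=> /val_inj.
Qed.

(** * Expansions over [k] in powers of a uniformizer *)

Section TotallyRamified.
Variables (k : fieldType) (K : fieldExtType k) (v : K -> int).
Hypothesis Hv : normalized_dvaluation v.
Hypothesis Hk : forall c : k, c != 0 -> ((\dim {:K})%:Z %| v c%:A)%Z.
Variable pi : K.
Hypotheses (pi0 : pi != 0) (Hpi : v pi = 1).

Local Notation n := (\dim {:K}).

Lemma alg_neq0 (c : k) : c != 0 -> c%:A != 0 :> K.
Proof. by move=> c0; rewrite scaler_eq0 negb_or c0 oner_neq0. Qed.

Lemma valZ (c : k) (x : K) : c != 0 -> x != 0 -> v (c *: x) = v c%:A + v x.
Proof. by move=> c0 x0; rewrite -[c *: x]mulr_algl (valM Hv) ?alg_neq0. Qed.

Lemma scale_unif_neq0 (c : k) (m : nat) : c != 0 -> c *: pi ^+ m != 0.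
Proof. by move=> c0; rewrite scaler_eq0 negb_or c0 expf_neq0. Qed.

Lemma val_scale_unif (c : k) (m : nat) :
  c != 0 -> v (c *: pi ^+ m) = v c%:A + m%:Z.
Proof. by move=> c0; rewrite valZ ?expf_neq0 // (valX Hv) // Hpi mul1r. Qed.

(* The nonzero terms have pairwise distinct valuations modulo [n], so the
   smallest valuation cannot cancel. *)
Lemma vge_unif_sum (c : 'I_n -> k) (N : int) :
  vge v (\sum_i c i *: pi ^+ i) N -> forall i, vge v (c i *: pi ^+ i) N.
Proof.
move=> HN i0; apply: contraT => Hi0.
pose P (i : 'I_n) := ~~ vge v (c i *: pi ^+ i) N.
have nz i : P i -> c i != 0.
  by apply: contraNneq => ->; rewrite scale0r vge0.
case: (@arg_minP _ _ _ i0 P (fun i => v (c i *: pi ^+ i)) Hi0) => i Pi mini.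
have ci := nz i Pi.
set w := v (c i *: pi ^+ i) in mini *.
suff : vge v (c i *: pi ^+ i) (w + 1).
  by rewrite vge_neq0 ?scale_unif_neq0 // gerDl.
have vi : w < N.
  by move: Pi; rewrite /P vge_neq0 ?scale_unif_neq0 // -ltNge.
have -> : c i *: pi ^+ i = \sum_i c i *: pi ^+ i
            - \sum_(j | j != i) c j *: pi ^+ j.
  by rewrite [X in _ = X - _](bigD1 i) //= addrK.
apply: vgeB => //; first by apply: vge_le HN; rewrite lezD1.
apply: vge_sum => // j ji.
have [Pj|] := boolP (P j); last first.
  by rewrite negbK; apply: vge_le; rewrite lezD1.
have := mini j Pj; rewrite /w; have cj := nz j Pj.
rewrite vge_neq0 ?scale_unif_neq0 // !val_scale_unif //.
have /dvdzP [a ->] := Hk ci; have /dvdzP [b ->] := Hk cj.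
rewrite lezD1 lt_neqAle => ->; rewrite andbT; apply: contraNneq ji => E.
by apply/eqP; apply: ord_mulz_inj (esym E).
Qed.

(** The powers [pi ^+ i], [i < n], are free, hence a basis by dimension; in the expansion of an
    integral [x] all terms but the constant one have positive valuation, so the constant coefficient
    serves as [c]. *)
Lemma exists_alg_congr (x : K) : vge v x 0 ->
  exists c : k, vge v c%:A 0 /\ vge v (x - c%:A) 1.
Proof.
have n0 : (0 < n)%N by rewrite adim_gt0.
pose X := [tuple pi ^+ (i : 'I_n) | i < n].
have XE (i : 'I_n) : X`_i = pi ^+ i.
  by rewrite (nth_map i) ?size_enum_ord // nth_ord_enum.
have freeX : free X.
  apply/freeP => c c0 i; apply/eqP; apply: contraT => ci.
  (* A vanishing sum lies in every power of the maximal ideal, so the bound may be set one above the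
     valuation of a nonzero term. *)
  have : vge v (\sum_i c i *: pi ^+ i) (v (c i *: pi ^+ i) + 1).
    by under eq_bigr => j _ do rewrite -XE; rewrite c0 vge0.
  by move/vge_unif_sum => /(_ i); rewrite vge_neq0 ?scale_unif_neq0 // gerDl.
have basX : basis_of fullv X.
  by rewrite basisEfree freeX subvf size_tuple leqnn.
move=> x0; have Ex := coord_basis basX (memvf x).
pose c i := coord X i x.
have {}Ex : x = \sum_(i < n) c i *: pi ^+ i.
  by rewrite {1}Ex; apply: eq_bigr => i _; rewrite XE.
have Hc i : vge v (c i *: pi ^+ i) 0 by apply: vge_unif_sum; rewrite -Ex.
exists (c (Ordinal n0)); split; first exact: (Hc (Ordinal n0)).
rewrite {1}Ex (bigD1 (Ordinal n0)) //= expr0 addrAC subrr add0r.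
apply: vge_sum => // i i0; have := Hc i.
have [->|ci] := eqVneq (c i) 0; first by rewrite scale0r !vge0.
rewrite !vge_neq0 ?scale_unif_neq0 // val_scale_unif //.
have i1 : (0 < i)%N by rewrite lt0n.
have /dvdzP [a ->] := Hk ci.
move: (ltn_ord i) i1; move: (nat_of_ord i) => m; move: n => N mN m1.
(* From [0 <= a * N + m] and [0 < m < N] one gets [0 <= a], hence [1 <= a * N + m]. *)
by have [a0|a0] := leP 0 a; nia.
Qed.

End TotallyRamified.

(** * The trace, the different and residues of traces *)

Section Trace.
Variables (k : fieldType) (K : splittingFieldType k) (v : K -> int).
Hypothesis Hgal : galois 1%VS {:K}.
Hypothesis Hv : normalized_dvaluation v.

Local Notation n := (\dim {:K}).
Local Notation Tr := (galTrace 1%VS {:K}).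

Hypothesis Hk : forall c : k, c != 0 -> (n%:Z %| v c%:A)%Z.
Hypothesis Hu : exists c : k, c != 0 /\ v c%:A = n%:Z.
Variable pi : K.
Hypotheses (pi0 : pi != 0) (Hpi : v pi = 1).
Variable d : int.
Hypothesis Hd : forall x : K,
  (forall y : K, vge v y 0 -> exists c : k, c%:A = Tr (x * y) /\ vge v c%:A 0)
  <-> vge v x (- (d + n%:Z - 1)).

Lemma n_gt0 : (0 < n)%N. Proof. by rewrite adim_gt0. Qed.

Lemma trD x y : Tr (x + y) = Tr x + Tr y.
Proof. by rewrite raddfD. Qed.

Lemma trZ (c : k) x : Tr (c *: x) = c *: Tr x.
Proof.
by rewrite /galTrace scaler_sumr; apply: eq_bigr => s _; rewrite linearZ.
Qed.

Lemma tr_alg x : exists c : k, Tr x = c%:A.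
Proof. exact/vlineP/(mem_galTrace Hgal)/memvf. Qed.

(** Such scalars shift valuations by multiples of [n], both through the trace and across the tensor
    sign. *)
Lemma exists_scalar_val (q : int) :
  exists c : k, c != 0 /\ v c%:A = q * n%:Z.
Proof.
case: Hu => u [u0 vu]; exists (u ^ q); split; first exact: expfz_neq0.
have -> : (u ^ q)%:A = (u%:A : K) ^ q by exact: (fmorphXz (in_alg K)).
by rewrite (valXz Hv) ?alg_neq0 // vu mulrC.
Qed.

Lemma val_scalarV (c : k) : c != 0 -> v c^-1%:A = - v c%:A.
Proof.
move=> c0; have -> : c^-1%:A = (c%:A : K)^-1 by exact: (fmorphV (in_alg K)).
by rewrite (valV Hv) ?alg_neq0.
Qed.

Lemma vge_scale (c : k) x j l : c != 0 -> vge v x j -> l <= v c%:A + j ->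
  vge v (c *: x) l.
Proof.
move=> c0 xj le; rewrite -mulr_algl; apply: (vgeM Hv) xj le.
by rewrite vge_neq0 ?alg_neq0.
Qed.

(** A nonzero scalar has valuation divisible by [n], so the bound [j] is not attained. This kills
    the coefficients with [j != j0] in [res_coef]. *)
Lemma vge_scalar_strict (c : k) j : ~~ (n%:Z %| j)%Z ->
  vge v c%:A j -> vge v c%:A (j + 1).
Proof.
have [->|c0] := eqVneq c 0; first by rewrite scale0r !vge0.
rewrite !vge_neq0 ?alg_neq0 // => Nj le; rewrite lezD1 lt_neqAle le andbT.
by apply: contraNneq Nj => ->; exact: Hk.
Qed.

Lemma vge_scalar_maximal (c : k) : vge v c%:A 1 -> vge v c%:A n%:Z.
Proof.
have [->|c0] := eqVneq c 0; first by rewrite scale0r !vge0.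
rewrite !vge_neq0 ?alg_neq0 //; have /dvdzP [a ->] := Hk c0.
move: n_gt0; move: n => N N0 aN.
have a1 : 1 <= a by rewrite leNgt; apply/negP => a1; nia.
nia.
Qed.

Lemma vge_trace w b : vge v w b -> vge v (Tr w) (b + d).
Proof.
(* [q] is the largest integer with [q * n <= b + d + n - 1]: then [c^-1 *: w] lies in the inverse
   different, while [q * n >= b + d]. *)
move=> wb; pose m := b + d + n%:Z - 1; pose q := (m %/ n%:Z)%Z.
have [c [c0 vc]] := exists_scalar_val q.
have [qm mq] : q * n%:Z <= m /\ m < q * n%:Z + n%:Z.
  have n0 := n_gt0; have nz : n%:Z != 0 by lia.
  have := divz_eq m n%:Z; have := modz_ge0 m nz.
  have : (m %% n%:Z)%Z < n%:Z by apply: ltz_pmod; lia.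
  by rewrite -/q; lia.
have cV0 : c^-1 != 0 by rewrite invr_eq0.
have w'b : vge v (c^-1 *: w) (- (d + n%:Z - 1)).
  apply: vge_scale wb _ => //; rewrite val_scalarV // vc.
  by move: mq; rewrite /m; lia.
have v1 : vge v 1 0 by rewrite vge_neq0 ?oner_neq0 ?(val1 Hv).
have [e [e1 e2]] := proj2 (Hd _) w'b 1 v1.
rewrite -[w](scalerKV c0) trZ; apply: (vge_scale (j := 0)) => //.
  by rewrite -[X in Tr X]mulr1 -e1.
by rewrite vc; move: mq; rewrite /m; lia.
Qed.

Variables (kbar : fieldType) (r : K -> kbar).
Hypothesis Hr : residue_map v r.

(** Modulo the maximal ideal [w * pi ^ d] is a scalar [e]; by linearity [e] leaves the trace, and
    the error term, of valuation at least [1 - d], has trace of residue zero. *)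
Lemma res_trace w : vge v w (- d) ->
  r (Tr w) = r (w * pi ^ d) * r (Tr (pi ^ (- d))).
Proof.
move=> wd.
have x0 : vge v (w * pi ^ d) 0 by apply: (vgeMu Hv pi0 Hpi) wd _; lia.
have [e [e0 xe]] := exists_alg_congr Hv Hk pi0 Hpi x0.
have Ew : w = e *: pi ^ (- d) + (w * pi ^ d - e%:A) * pi ^ (- d).
  rewrite mulrBl -mulrA -expfzDr // subrr mulr1 mulr_algl.
  by rewrite addrCA subrr addr0.
have T0 : vge v (Tr (pi ^ (- d))) 0.
  by rewrite -(addNr d); apply/vge_trace/vge_unif.
have T1 : vge v (Tr ((w * pi ^ d - e%:A) * pi ^ (- d))) 1.
  apply: (@vge_le _ _ _ _ (1 - d + d)); first by lia.
  by apply: vge_trace; apply: (vgeMu Hv pi0 Hpi) xe _.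
rewrite {1}Ew trD trZ -[e *: Tr _]mulr_algl (resD Hr) ?(resM Hr e0 T0).
- by rewrite (res_eq0 Hr T1) addr0 (res_congr Hr e0 xe).
- exact: (vgeM Hv) e0 T0 _.
- exact: vge_le T1.
Qed.

Lemma res_trace_unif_neq0 : r (Tr (pi ^ (- d))) != 0.
Proof.
(* If the residue vanished, all traces from the [- d]-th power of the maximal ideal would have
   valuation at least [n], so [c *: pi ^ (- d)] would lie in the inverse different; its valuation
   [- d - n] is one too small. *)
have [c [c0 vc]] := exists_scalar_val (-1).
apply/eqP => T0.
have : vge v (c *: pi ^ (- d)) (- (d + n%:Z - 1)).
  apply/Hd => y y0; have wd : vge v (pi ^ (- d) * y) (- d).
    by apply: (vgeM Hv) (vge_unif Hv pi0 Hpi _) y0 _; rewrite addr0.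
  have [e Ee] := tr_alg (pi ^ (- d) * y).
  have e1 : vge v e%:A 1.
    case: (Hr) => _ _ _ H _; rewrite -H; last first.
      by rewrite -Ee -(addNr d); apply: vge_trace.
    by rewrite -Ee res_trace // T0 mulr0.
  exists (c * e); rewrite -scalerAl trZ Ee scalerA; split=> //.
  rewrite -scalerA; apply: vge_scale (vge_scalar_maximal e1) _ => //.
  by rewrite vc; lia.
rewrite vge_neq0 ?scaler_eq0 ?negb_or ?c0 ?unif_neq0 // (valZ Hv) ?unif_neq0 //.
by rewrite vc (val_unif Hv) //; lia.
Qed.

(** The gain [d] of the trace offsets the shift by [d + i]. Integrality is needed because [r] is
    additive only on integral elements. *)
Lemma vge_coef (a i : int) (x y : K) (j : nat) :
  vge v x a -> vge v y (i - a) ->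
  vge v (x * Tr (y * pi ^ (j%:Z - (d + i))) / pi ^+ j) 0.
Proof.
move=> xa yi; rewrite exprnN.
have w : vge v (y * pi ^ (j%:Z - (d + i))) (j%:Z - d - a).
  by apply: (vgeMu Hv pi0 Hpi) yi _; lia.
apply: (vgeMu Hv pi0 Hpi (j := j%:Z)); last by lia.
by apply: (vgeM Hv) xa (vge_trace w) _; lia.
Qed.

(** For [j = j0] a scalar of valuation [q * n] moves from [x] into the trace, both factors become
    integral and [res_trace] applies. Otherwise the bound [j - a] on the trace is not divisible by
    [n], so the trace gains one unit of valuation. *)
Lemma res_coef (q i : int) (j0 j : 'I_n) (x y : K) :
  vge v x (q * n%:Z + j0%:Z) -> vge v y (i - (q * n%:Z + j0%:Z)) ->
  r (x * Tr (y * pi ^ (j%:Z - (d + i))) / pi ^+ j) =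
  if j == j0 then r (x * y * pi ^ (- i)) * r (Tr (pi ^ (- d))) else 0.
Proof.
set a := q * _ + _ => xa ya.
have Vj : (pi ^+ j)^-1 = pi ^ (- j%:Z) by rewrite exprnN.
have w : vge v (y * pi ^ (j%:Z - (d + i))) (j%:Z - d - a).
  by apply: (vgeMu Hv pi0 Hpi) ya _; lia.
case: eqVneq => [Ej|Nj].
  have [c [c0 vc]] := exists_scalar_val q.
  have wd : vge v (c *: (y * pi ^ (j%:Z - (d + i)))) (- d).
    by apply: vge_scale w _ => //; rewrite vc /a Ej; lia.
  have x'0 : vge v (c^-1 *: x * pi ^ (- j%:Z)) 0.
    apply: (vgeMu Hv pi0 Hpi (j := j%:Z)); last by lia.
    by apply: vge_scale xa _; rewrite ?invr_eq0 // val_scalarV // vc /a Ej; lia.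
  have -> : x * Tr (y * pi ^ (j%:Z - (d + i))) / pi ^+ j =
            (c^-1 *: x * pi ^ (- j%:Z)) * Tr (c *: (y * pi ^ (j%:Z - (d + i)))).
    rewrite trZ Vj -!scalerAl -!scalerAr scalerA mulVf // scale1r.
    by rewrite -!mulrA [pi ^ _ * _]mulrC.
  have T0 : vge v (Tr (c *: (y * pi ^ (j%:Z - (d + i))))) 0.
    by rewrite -(addNr d); apply: vge_trace.
  rewrite (resM Hr x'0 T0) (res_trace wd) mulrA -(resM Hr) //; last first.
    by apply: (vgeMu Hv pi0 Hpi) wd _; lia.
  congr (r _ * _); rewrite -!scalerAl -!scalerAr scalerA mulVf // scale1r.
  rewrite -!mulrA; congr (x * _); rewrite mulrCA; congr (y * _).
  rewrite -!expfzDr //; congr (pi ^ _); lia.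
rewrite Vj; apply: (res_eq0 Hr).
apply: (vgeMu Hv pi0 Hpi (j := j%:Z + 1)); last by lia.
have [c Tc] := tr_alg (y * pi ^ (j%:Z - (d + i))).
have := vge_trace w; rewrite Tc => c1.
have := vge_scalar_strict _ c1 => c2.
apply: (vgeM Hv) xa (c2 _) _; last by lia.
apply: contra Nj => /dvdzP [b E]; apply/eqP.
by apply: (@ord_mulz_inj _ 0 (b + q)); rewrite /a in E; lia.
Qed.

End Trace.

(** * The tensor square and its filtration *)

Section TensorSquare.
Variables (k : fieldType) (K : fieldExtType k) (T : comAlgType k).
Variable tens : K -> K -> T.
Hypothesis HT : tensor_square tens.

Lemma tensDl x x' y : tens (x + x') y = tens x y + tens x' y.
Proof. by case: HT => [[_ H] _ _ _]; rewrite -[x]scale1r H !scale1r. Qed.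

Lemma tensDr x y y' : tens x (y + y') = tens x y + tens x y'.
Proof. by case: HT => [[H _] _ _ _]; rewrite -[y]scale1r H !scale1r. Qed.

Lemma tensZl c x y : tens (c *: x) y = c *: tens x y.
Proof. by case: HT => [[_ H] _ _ _]; exact: (GRing.scalable_linear (H y)). Qed.

Lemma tensZr c x y : tens x (c *: y) = c *: tens x y.
Proof. by case: HT => [[H _] _ _ _]; exact: (GRing.scalable_linear (H x)). Qed.

Lemma tensM x y x' y' : tens x y * tens x' y' = tens (x * x') (y * y').
Proof. by case: HT => [_ _ H _]; exact: H. Qed.

(** This is the uniqueness half of the universal property, for the bilinear map induced by [g]. *)
Lemma tens_ext (W : lmodType k) (f g : T -> W) :
  linear f -> linear g -> (forall x y, f (tens x y) = g (tens x y)) -> f =1 g.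
Proof.
move=> lf lg fg; case: HT => [[lr ll] UP _ _].
have bil : bilinear_map (fun x y => g (tens x y)).
  by split=> [x|y] a u w /=; rewrite ?lr ?ll lg.
have [h [_ _ uniq]] := UP _ _ bil.
by move=> z; rewrite (uniq f) // (uniq g).
Qed.

Variable v : K -> int.
Hypothesis Hv : normalized_dvaluation v.

Lemma inX0 i : inX v tens i 0.
Proof. by exists [::]; split; rewrite ?big_nil. Qed.

Lemma inXD i a b : inX v tens i a -> inX v tens i b -> inX v tens i (a + b).
Proof.
case=> s [s1 s2 ->] [s' [s'1 s'2 ->]]; exists (s ++ s').
split; rewrite ?all_cat ?s1 ?big_cat // => p.
by rewrite mem_cat => /orP[/s2|/s'2].
Qed.

Lemma inX_tens i j x y :
  vge v x j -> vge v y (i - j) -> inX v tens i (tens x y).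
Proof.
move=> xj yj; exists [:: (1, x, y)]; split.
- by rewrite /= scale1r vge_neq0 ?oner_neq0 // (val1 Hv).
- by move=> p; rewrite inE => /eqP ->; exists j; rewrite xj.
- by rewrite big_seq1 /= scale1r.
Qed.

(** The integral scalar of each generator is absorbed into its left factor, so only pure tensors
    have to be treated. *)
Lemma inX_ind i (P : T -> Prop) :
  P 0 -> (forall a b, P a -> P b -> P (a + b)) ->
  (forall x y j, vge v x j -> vge v y (i - j) -> P (tens x y)) ->
  forall a, inX v tens i a -> P a.
Proof.
move=> P0 PD Pt a [s [+ + ->]]; elim: s => [|p s IHs] /=.
  by rewrite big_nil.
move=> /andP[p0 s0] sP; rewrite big_cons; apply: PD; last first.
  by apply: IHs => // q qs; apply: sP; rewrite inE qs orbT.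
have [j /andP[xj yj]] := sP p (mem_head _ _).
rewrite -tensZl; apply: (Pt _ _ j) => //.
by rewrite -mulr_algl; apply: (vgeM Hv) p0 xj _; rewrite add0r.
Qed.

Lemma inX_le i j a : i <= j -> inX v tens j a -> inX v tens i a.
Proof.
move=> le_ij; apply: inX_ind => [||x y l xl yl]; [exact: inX0|exact: inXD|].
apply: inX_tens xl _; apply: vge_le yl; lia.
Qed.

End TensorSquare.

(** * The action of the group ring and additivity of [p_map] *)

Section GroupRing.
Variables (k : fieldType) (K : splittingFieldType k).
Implicit Types f g : {ffun gal_of {:K} -> K}.

Lemma gr_act0 x : gr_act (0 : {ffun gal_of {:K} -> K}) x = 0.
Proof. by rewrite /gr_act big1 // => s _; rewrite ffunE mul0r. Qed.

Lemma gr_actD f g x : gr_act (f + g) x = gr_act f x + gr_act g x.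
Proof. by rewrite -big_split; apply: eq_bigr => s _; rewrite ffunE mulrDl. Qed.

Lemma gr_act_trace (x y z : K) :
  gr_act [ffun s : gal_of {:K} => x * s y] z = x * galTrace 1%VS {:K} (y * z).
Proof.
by rewrite mulr_sumr; apply: eq_bigr => s _; rewrite ffunE rmorphM mulrA.
Qed.

Variables (v : K -> int) (kbar : fieldType) (r : K -> kbar).
Hypothesis Hr : residue_map v r.
Variables (n : nat) (pi cpi : K) (l : int).

Lemma p_map0 : p_map r n pi cpi l 0 = 0.
Proof.
rewrite /p_map big1 ?scaler0 // => j _.
by rewrite gr_act0 mul0r (res_eq0 Hr) ?vge0 // scale0r.
Qed.

Lemma p_mapD f g :
  (forall j : 'I_n, vge v (gr_act f (pi ^ (j%:Z - l)) / pi ^+ j) 0) ->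
  (forall j : 'I_n, vge v (gr_act g (pi ^ (j%:Z - l)) / pi ^+ j) 0) ->
  p_map r n pi cpi l (f + g) = p_map r n pi cpi l f + p_map r n pi cpi l g.
Proof.
move=> f0 g0; rewrite /p_map -scalerDr -big_split; congr (_ *: _).
by apply: eq_bigr => j _; rewrite gr_actD mulrDl (resD Hr) // scalerDl.
Qed.

End GroupRing.

(** * The swap of factors, and arithmetic modulo [X^n - 1] *)

Lemma swap_gr (k : fieldType) (K : splittingFieldType k) (T : comAlgType k)
  (tens : K -> K -> T) (HT : tensor_square tens)
  (t : T -> T) (Ht : linear t) (Htt : forall x y, t (tens x y) = tens y x)
  (phi : T -> {ffun gal_of {:K} -> K}) (Hphi : linear phi)
  (Hphit : forall x y, phi (tens x y) = [ffun s : gal_of {:K} => x * s y])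
  (alpha : T) :
  phi (t alpha) = [ffun s : gal_of {:K} => s (phi alpha s^-1%g)].
Proof.
apply: (tens_ext HT (f := fun a => phi (t a))
  (g := fun a => [ffun s : gal_of {:K} => s (phi a s^-1%g)])).
- by move=> c a b; rewrite Ht Hphi.
- by move=> c a b; apply/ffunP => s; rewrite Hphi !ffunE linearP.
- move=> x y; rewrite Htt !Hphit; apply/ffunP => s; rewrite !ffunE rmorphM.
  (* Galois products compose from left to right, so applying [s] after [s^-1] is the action of
     [s^-1 * s]. *)
  by rewrite /= -(galM s^-1%g s (memvf y)) mulVg gal_id mulrC.
Qed.

Lemma redRD (F : fieldType) n (p q : {poly F}) :
  redR n (p + q) = redR n p + redR n q.
Proof. exact: modpD. Qed.

Lemma redRZ (F : fieldType) n (c : F) (p : {poly F}) :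
  redR n (c *: p) = c *: redR n p.
Proof. exact: modpZl. Qed.

Lemma redRM (F : fieldType) n (p p' q q' : {poly F}) :
  redR n p = redR n p' -> redR n q = redR n q' ->
  redR n (p * q) = redR n (p' * q').
Proof.
have H a b : redR n (a * b) = redR n (redR n a * redR n b).
  by rewrite /redR modp_mul [in RHS]mulrC modp_mul mulrC.
by move=> pp' qq'; rewrite H pp' qq' -H.
Qed.

Lemma exists_divz_ord (n : nat) (a : int) : (0 < n)%N ->
  exists (q : int) (j : 'I_n), a = q * n%:Z + j%:Z.
Proof.
move=> n0; have nz : n%:Z != 0 by lia.
have lt : (`|(a %% n%:Z)%Z| < n)%N.
  by rewrite -ltz_nat gez0_abs ?modz_ge0 // ltz_pmod.
exists (a %/ n%:Z)%Z, (Ordinal lt).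
by rewrite {1}(divz_eq a n%:Z) /= gez0_abs ?modz_ge0.
Qed.

(** * The map [rX] on pure tensors *)

Section Reduction.
Variables (k : fieldType) (K : splittingFieldType k) (v : K -> int).
Hypothesis Hv : normalized_dvaluation v.
Local Notation n := (\dim {:K}).
Hypothesis Hk : forall c : k, c != 0 -> (n%:Z %| v c%:A)%Z.
Hypothesis Hu : exists c : k, c != 0 /\ v c%:A = n%:Z.
Variables (kbar : fieldType) (r : K -> kbar).
Hypothesis Hr : residue_map v r.
Variable pi : K.
Hypothesis Hpi : v pi = 1.
Variables (T : comAlgType k) (tens : K -> K -> T).
Hypothesis HT : tensor_square tens.
Variable rX : T -> {poly kbar}.
Hypothesis HrXD : forall a b, inX v tens 0 a -> inX v tens 0 b ->
  redR n (rX (a + b)) = redR n (rX a + rX b).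
Hypothesis HrXM : forall a b, inX v tens 0 a -> inX v tens 0 b ->
  redR n (rX (a * b)) = redR n (rX a * rX b).
Hypothesis HrX1 : redR n (rX 1) = redR n 1.
Hypothesis HrXZ : forall (c : k) a, vge v c%:A 0 -> inX v tens 0 a ->
  redR n (rX (c *: a)) = redR n (r c%:A *: rX a).
Hypothesis HrXker : forall a, inX v tens 0 a ->
  (redR n (rX a) = 0 <-> inX v tens 1 a).
Hypothesis HrXpi : redR n (rX (tens pi pi^-1)) = redR n 'X.

Lemma rX_eq0 a : inX v tens 1 a -> redR n (rX a) = 0.
Proof. by move=> a1; apply/(HrXker (inX_le HT Hv ler01 a1)). Qed.

(* [v 0] is a junk value, so [v pi = 1] alone does not exclude [pi = 0]; the
   reduction of [pi (x) pi^-1] does. *)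
Lemma unif_neq0_of_rX : pi != 0.
Proof.
(* If [pi] were zero, the class of [X], and so that of [X^n], would vanish, whereas [X^n] is
   congruent to [1]. *)
apply/eqP => pi0; have : redR n ('X^n : {poly kbar}) = redR n 0.
  rewrite -[X in 'X^X](prednK (n_gt0 K)) exprS -(mul0r ('X^(n.-1))).
  apply: redRM => //; rewrite -HrXpi pi0 -(scale0r 0) (tensZl HT) scale0r.
  by rewrite rX_eq0 /redR ?mod0p //; exact: inX0.
rewrite -(subrK 1 'X^n) redRD {1}/redR modpp add0r /redR mod0p modp_small.
  by move/eqP; rewrite oner_eq0.
by rewrite size_XnsubC ?size_poly1 ?ltnS n_gt0.
Qed.

Let pi0 := unif_neq0_of_rX.

Lemma inX0_unif (m : nat) : inX v tens 0 (tens (pi ^+ m) (pi ^- m)).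
Proof.
apply: (inX_tens tens Hv (j := m%:Z)); first exact: (vge_unif Hv pi0 Hpi m).
by rewrite exprnN sub0r; exact: (vge_unif Hv pi0 Hpi).
Qed.

Lemma rX_unif (m : nat) :
  redR n (rX (tens (pi ^+ m) (pi ^- m))) = redR n 'X^m.
Proof.
elim: m => [|m IHm]; first by case: HT => _ _ _ H; rewrite !expr0 invr1 H.
rewrite !exprS invfM -(tensM HT) HrXM; first exact: redRM.
  exact: (inX0_unif 1).
exact: inX0_unif.
Qed.

(** A scalar of valuation [q * n] crosses the tensor sign, reducing to [q = 0]. Then [x] and [y] are
    scalar multiples of [pi ^ j] and [pi ^ (- j)] up to errors [x1], [y1]; the terms containing an
    error lie in the kernel of [rX], and [rX_unif] gives the leading one. *)
Lemma rX_tens (q : int) (j : 'I_n) (x y : K) :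
  vge v x (q * n%:Z + j%:Z) -> vge v y (- (q * n%:Z + j%:Z)) ->
  redR n (rX (tens x y)) = redR n (r (x * y) *: 'X^j).
Proof.
have [c [c0 vc]] := exists_scalar_val Hv Hu q => xa ya.
have -> : tens x y = tens (c^-1 *: x) (c *: y).
  by rewrite (tensZl HT) (tensZr HT) scalerA mulVf // scale1r.
have -> : x * y = (c^-1 *: x) * (c *: y).
  by rewrite -scalerAl -scalerAr scalerA mulVf // scale1r.
have cV0 : c^-1 != 0 by rewrite invr_eq0.
have {xa} : vge v (c^-1 *: x) j%:Z.
  by apply: (vge_scale Hv) xa _ => //; rewrite (val_scalarV Hv) // vc; lia.
have {ya} : vge v (c *: y) (- j%:Z).
  by apply: (vge_scale Hv) ya _ => //; rewrite vc; lia.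
move: (c^-1 *: x) (c *: y) => {}x {}y yj xj.
have x0 : vge v (x * pi ^ (- j%:Z)) 0 by apply: (vgeMu Hv pi0 Hpi) xj _; lia.
have y0 : vge v (y * pi ^ j%:Z) 0 by apply: (vgeMu Hv pi0 Hpi) yj _; lia.
have [e [e0 xe]] := exists_alg_congr Hv Hk pi0 Hpi x0.
have [f [f0 yf]] := exists_alg_congr Hv Hk pi0 Hpi y0.
have Vu : pi ^ (- j%:Z) * pi ^ j%:Z = 1.
  by rewrite -expfzDr // addNr expr0z.
pose x1 := (x * pi ^ (- j%:Z) - e%:A) * pi ^ j%:Z.
pose y1 := (y * pi ^ j%:Z - f%:A) * pi ^ (- j%:Z).
have x1j : vge v x1 (j%:Z + 1) by apply: (vgeMu Hv pi0 Hpi) xe _; rewrite addrC.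
have y1j : vge v y1 (1 - j%:Z) by exact: (vgeMu Hv pi0 Hpi yf).
have xE : x = e *: pi ^ j%:Z + x1.
  by rewrite /x1 mulrBl -mulrA Vu mulr1 mulr_algl addrCA subrr addr0.
have yE : y = f *: pi ^ (- j%:Z) + y1.
  rewrite /y1 mulrBl -mulrA [pi ^ j%:Z * _]mulrC Vu mulr1 mulr_algl.
  by rewrite addrCA subrr addr0.
have ej : vge v (e *: pi ^ j%:Z) j%:Z.
  rewrite -mulr_algl; apply: (vgeM Hv) e0 (vge_unif Hv pi0 Hpi _) _.
  by rewrite add0r.
have E : tens x y = (e * f) *: tens (pi ^+ j) (pi ^- j)
           + (tens (e *: pi ^ j%:Z) y1 + tens x1 y).
  rewrite {1}xE (tensDl HT) {1}yE (tensDr HT) addrA; congr (_ + _ + _).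
  by rewrite (tensZl HT) (tensZr HT) scalerA exprnN.
have X1 : inX v tens 1 (tens (e *: pi ^ j%:Z) y1 + tens x1 y).
  apply: inXD; first exact: (inX_tens tens Hv ej y1j).
  apply: (inX_tens tens Hv x1j); apply: vge_le yj.
  by rewrite opprD addrCA subrr addr0.
have efA : (e * f)%:A = e%:A * f%:A :> K by rewrite mulr_algl scalerA.
have ef0 : vge v (e * f)%:A 0 by rewrite efA; exact: (vgeM Hv e0 f0).
have X0 : inX v tens 0 ((e * f) *: tens (pi ^+ j) (pi ^- j)).
  rewrite -scalerA -(tensZr HT) -(tensZl HT).
  apply: (inX_tens tens Hv ej); rewrite sub0r -mulr_algl exprnN.
  by apply: (vgeM Hv) f0 (vge_unif Hv pi0 Hpi _) _; rewrite add0r.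
rewrite E HrXD // ?redRD ?(rX_eq0 X1) ?addr0; last first.
  exact: (inX_le HT Hv ler01 X1).
rewrite HrXZ //; last exact: inX0_unif.
rewrite !redRZ rX_unif; congr (_ *: _).
rewrite efA (resM Hr) // -(res_congr Hr e0 xe) -(res_congr Hr f0 yf).
rewrite -(resM Hr) //; congr r.
by rewrite mulrACA Vu mulr1.
Qed.

End Reduction.

Unset Implicit Arguments.
Set Strict Implicit.
Set Printing Implicit Defensive.

Theorem theorem2p2p2
  (k : fieldType) (K : splittingFieldType k)
  (* K/k finite Galois, G = Gal(K/k), n = [K:k] *)
  (Hgal : galois 1%VS {:K})
  (n : nat) (Hn : n = \dim {:K})
  (* valuation of K, normalized, complete; k complete *)
  (v : K -> int) (Hv : normalized_dvaluation v) (HKc : vcomplete v)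
  (Hkc : vcomplete_base v)
  (* totally ramified: v(k^* ) = nZ *)
  (Htr : (forall c : k, c != 0 -> (n%:Z %| v c%:A)%Z) /\
         (exists c : k, c != 0 /\ v c%:A = n%:Z))
  (* the residue field and the reduction map *)
  (kbar : fieldType) (r : K -> kbar) (Hr : residue_map v r)
  (* the uniformizer *)
  (pi : K) (Hpi : v pi = 1)
  (* ramification depth d = v(D_{K/k}) - n + 1, where the inverse different is
     {x | Tr(x O_K) \subset O_k} = m^{-v(D)} *)
  (d : int)
  (Hd : forall x : K,
      (forall y : K, vge v y 0 ->
         exists c : k, c%:A = galTrace 1%VS {:K} (x * y) /\ vge v c%:A 0)
      <-> vge v x (- (d + n%:Z - 1)))
  (* the tensor product K (x)_k K *)
  (T : comAlgType k) (tens : K -> K -> T) (HT : tensor_square tens)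
  (* the swap t *)
  (t : T -> T) (Ht : linear t) (Htt : forall x y, t (tens x y) = tens y x)
  (* phi : K (x)_k K -> K[G] *)
  (phi : T -> {ffun gal_of {:K} -> K}) (Hphi : linear phi)
  (Hphit : forall x y, phi (tens x y) = [ffun s : gal_of {:K} => x * s y])
  (* r_X : X_0/X_1 -> R = kbar[X]/(X^n-1), the unital kbar-algebra isomorphism
     sending the class of pi (x) pi^{-1} to X *)
  (rX : T -> {poly kbar})
  (HrXD : forall a b, inX v tens 0 a -> inX v tens 0 b ->
            redR n (rX (a + b)) = redR n (rX a + rX b))
  (HrXM : forall a b, inX v tens 0 a -> inX v tens 0 b ->
            redR n (rX (a * b)) = redR n (rX a * rX b))
  (HrX1 : redR n (rX 1) = redR n 1)
  (HrXZ : forall (c : k) a, vge v c%:A 0 -> inX v tens 0 a ->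
            redR n (rX (c *: a)) = redR n (r c%:A *: rX a))
  (HrXker : forall a, inX v tens 0 a -> (redR n (rX a) = 0 <-> inX v tens 1 a))
  (HrXsurj : forall p : {poly kbar}, exists a, inX v tens 0 a /\ redR n (rX a) = redR n p)
  (HrXpi : redR n (rX (tens pi pi^-1)) = redR n 'X) :
  (* (5) *)
  (forall (i : int) (alpha : T), inX v tens i alpha ->
      inX v tens 0 (alpha * tens 1 (pi ^ (- i))) /\
      redR n (rX (alpha * tens 1 (pi ^ (- i)))) =
      redR n (p_map r n pi (galTrace 1%VS {:K} (pi ^ (- d))) (d + i) (phi alpha)))
  /\
  (* (6) *)
  (forall alpha : T,
      phi (t alpha) = [ffun s : gal_of {:K} => s (phi alpha s^-1%g)]).
Proof.
case: Htr => Hk Hu; subst n.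
have pi0 : pi != 0 by exact: (unif_neq0_of_rX Hv HT HrXker HrXpi).
split; last exact: (swap_gr HT Ht Htt Hphi Hphit).
move=> i alpha; set cpi := galTrace _ _ _.
have phiB := GRing.zmod_morphism_linear Hphi.
have phi0 : phi 0 = 0 by rewrite -(subrr (0 : T)) phiB subrr.
have phiD a b : phi (a + b) = phi a + phi b.
  by rewrite -[b in LHS]opprK phiB -[- b]sub0r phiB phi0 sub0r opprK.
(* Integrality of the coefficients joins the induction, since [p_mapD] requires it for both
   summands. *)
suff main a : inX v tens i a ->
  [/\ inX v tens 0 (a * tens 1 (pi ^ (- i))),
      redR (\dim {:K}) (rX (a * tens 1 (pi ^ (- i)))) =
      redR (\dim {:K}) (p_map r (\dim {:K}) pi cpi (d + i) (phi a))
    & forall j : 'I_(\dim {:K}),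
        vge v (gr_act (phi a) (pi ^ (j%:Z - (d + i))) / pi ^+ j) 0].
  by case/main.
move: a; apply: (inX_ind HT Hv) => [|a b|x y a xa ya].
- rewrite mul0r phi0 (p_map0 Hr); split; first exact: inX0.
    by rewrite (rX_eq0 Hv HT HrXker) /redR ?mod0p //; exact: inX0.
  by move=> j; rewrite gr_act0 mul0r vge0.
- move=> [a0 aE ag] [b0 bE bg]; rewrite mulrDl phiD; split; first exact: inXD.
    by rewrite HrXD // (p_mapD Hr) // !redRD aE bE.
  by move=> j; rewrite gr_actD mulrDl (vgeD Hv).
have y'a : vge v (y * pi ^ (- i)) (- a).
  by apply: (vgeMu Hv pi0 Hpi) ya _; lia.
rewrite (tensM HT) mulr1 Hphit; split.
- by apply: (inX_tens tens Hv xa); rewrite sub0r.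
- have [q [j0 Ea]] := exists_divz_ord a (n_gt0 K).
  rewrite Ea in xa ya y'a.
  rewrite (rX_tens Hv Hk Hu Hr Hpi HT HrXD HrXM HrX1 HrXZ HrXker HrXpi xa y'a).
  congr (redR _ _); rewrite /p_map (bigD1 j0) //= big1 ?addr0 => [|j jj0].
    rewrite gr_act_trace (res_coef Hgal Hv Hk Hu pi0 Hpi Hd Hr _ xa ya) eqxx.
    (* The normalization [(r cpi)^-1] in [p_map] cancels the residue of the trace produced by
       [res_coef]. *)
    rewrite scalerA [_ * r cpi]mulrC mulKf ?mulrA //.
    exact: (res_trace_unif_neq0 Hgal Hv Hk Hu pi0 Hpi Hd Hr).
  rewrite gr_act_trace (res_coef Hgal Hv Hk Hu pi0 Hpi Hd Hr _ xa ya).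
  by rewrite (negPf jj0) scale0r.
- by move=> j; rewrite gr_act_trace (vge_coef Hgal Hv Hu pi0 Hpi Hd _ xa ya).
Qed.
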